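(* If $\overline{S}<1$, where $\overline S=\max_{1\le i\le n}\{\|p_i\|_\infty+\|\tilde p_i\|_\infty,\ \|q_i\|_\infty+\|\tilde q_i\|_\infty\}$, then there exists a metric $\rho_\theta$ on $\mathbb{R}^3$, equivalent to the Euclidean metric, such that each of the maps $\omega_i$, $i=1,\dots,n$, is contractive on $I\times E$ with respect to $\rho_\theta$; that is, there is a constant $\kappa<1$ with $\rho_\theta(\omega_i(u),\omega_i(v))\le\kappa\,\rho_\theta(u,v)$ for all $u,v\in I\times E$ and all $i\in\{1,\dots,n\}$.
   Context: Data: $n\ge 2$, real numbers $x_0<x_1<\dots<x_n$, and points $(x_i,y_i,z_i)\in\mathbb{R}^3$, $i=0,\dots,n$ (the $z_i$ are arbitrary real parameters). A signature $\varepsilon=(\varepsilon_1,\dots,\varepsilon_n)\in\{0,1\}^n$ is given. Put $I=[x_0,x_n]$, $I_i=[x_{i-1},x_i]$ for $i=1,\dots,n$. The map $L_i:I\to I_i$ is the affine map $L_i(x)=a_ix+b_i$ with $L_i(x_0)=x_{i-1+\varepsilon_i}$ and $L_i(x_n)=x_{i-\varepsilon_i}$. Vertical scaling factors: $p_i,q_i,\tilde p_i,\tilde q_i:I_i\to\mathbb{R}$ are Lipschitz functions with $\|p_i\|_\infty+\|\tilde p_i\|_\infty<1$ and $\|q_i\|_\infty+\|\tilde q_i\|_\infty<1$, where $\|\cdot\|_\infty$ is the sup norm. For $x\in I$ let $\mu=\frac{x-x_0}{x_n-x_0}$ and define $r_i(x)=[\mu y_{i-\varepsilon_i}+(1-\mu)y_{i-1+\varepsilon_i}]-p_i(L_i(x))[\mu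 y_n+(1-\mu)y_0]-q_i(L_i(x))[\mu z_n+(1-\mu)z_0]$, $\tilde r_i(x)=[\mu z_{i-\varepsilon_i}+(1-\mu)z_{i-1+\varepsilon_i}]-\tilde p_i(L_i(x))[\mu y_n+(1-\mu)y_0]-\tilde q_i(L_i(x))[\mu z_n+(1-\mu)z_0]$. Define $\mathbf F_i=(F_{i,1},F_{i,2}):I\times\mathbb{R}^2\to\mathbb{R}^2$ by $F_{i,1}(x,y,z)=p_i(L_i(x))y+q_i(L_i(x))z+r_i(x)$, $F_{i,2}(x,y,z)=\tilde p_i(L_i(x))y+\tilde q_i(L_i(x))z+\tilde r_i(x)$. Let $E=[-U,U]\times[-\tilde U,\tilde U]$ where $U=\max_{1\le i\le n}\frac{\|q_i\|_\infty\|\tilde r_i\|_\infty+(1-\|\tilde q_i\|_\infty)\|r_i\|_\infty}{(1-\|p_i\|_\infty)(1-\|\tilde q_i\|_\infty)-\|\tilde p_i\|_\infty\|q_i\|_\infty}$, $\tilde U=\max_{1\le i\le n}\frac{\|\tilde p_i\|_\infty\|r_i\|_\infty+(1-\|p_i\|_\infty)\|\tilde r_i\|_\infty}{(1-\|p_i\|_\infty)(1-\|\tilde q_i\|_\infty)-\|\tilde p_i\|_\infty\|q_i\|_\infty}$. The maps $\omega_i$ are defined on $I\times E$ by $\omega_i(x,y,z)=(L_i(x),\mathbf F_i(x,y,z))\in I_i\times\mathbb{R}^2$. *)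

(* Defs.v *)
From mathcomp Require Export all_boot all_order all_algebra.
From mathcomp Require Export all_classical all_reals all_analysis.
Export numFieldNormedType.Exports.
Export Order.TTheory GRing.Theory Num.Theory.

Set Implicit Arguments.
Unset Strict Implicit.
Unset Printing Implicit Defensive.

Local Open Scope classical_set_scope.
Local Open Scope ring_scope.

(* R^3 is encoded as R * (R * R), matching I x E with E a subset of R^2. *)
Definition R3 (R : realType) : Type := (R * (R * R))%type.

(* The canonical norm of R * (R * R) is the max norm, hence this definition. *)
Definition euclidean_dist (R : realType) (u v : R3 R) : R :=
  Num.sqrt ((u.1 - v.1) ^+ 2 + (u.2.1 - v.2.1) ^+ 2 + (u.2.2 - v.2.2) ^+ 2).

Definition is_metric (R : realType) (T : Type) (d : T -> T -> R) : Prop :=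
  [/\ forall u v, 0 <= d u v,
      forall u v, d u v = 0 <-> u = v,
      forall u v, d u v = d v u &
      forall u v w, d u w <= d u v + d v w].

(* Equivalence in the sense usual for iterated function systems: the identity
   is bi-Lipschitz (so the two metrics also induce the same topology). *)
Definition equivalent_metrics (R : realType) (T : Type)
    (d1 d2 : T -> T -> R) : Prop :=
  exists c C : R, [/\ 0 < c, 0 < C &
    forall u v, c * d1 u v <= d2 u v <= C * d1 u v].

(* This is the mathematical sup norm on A only when A is nonempty and f is
   bounded on A. *)
Definition supnorm (R : realType) (A : set R) (f : R -> R) : R :=
  sup [set `|f t| | t in A].

(* The sequences indexed by nat are meaningful only for 0 <= i <= n (nodes) or
   1 <= i <= n (maps); the functions dp i, dq i, dpt i, dqt i stand for p_i,
   q_i, \tilde p_i, \tilde q_i and only their values on I_i matter. The data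
   da i, db i are the coefficients of the affine map L_i. *)
Record fif_data (R : realType) := FifData {
  dn : nat;
  dx : nat -> R;
  dy : nat -> R;
  dz : nat -> R;
  deps : nat -> bool;
  da : nat -> R;
  db : nat -> R;
  dp : nat -> R -> R;
  dq : nat -> R -> R;
  dpt : nat -> R -> R;
  dqt : nat -> R -> R
}.

Definition II (R : realType) (D : fif_data R) : set R :=
  `[dx D 0%N, dx D (dn D)].

Definition Ii (R : realType) (D : fif_data R) (i : nat) : set R :=
  `[dx D i.-1, dx D i].

(* The images of 0 and n under the i-th index map; deps D i : bool is coerced
   to nat, and i >= 1 makes the truncated subtraction harmless. *)
Definition idx0 (R : realType) (D : fif_data R) (i : nat) : nat :=
  (i - 1 + deps D i)%N.
Definition idxn (R : realType) (D : fif_data R) (i : nat) : nat :=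
  (i - deps D i)%N.

Definition L (R : realType) (D : fif_data R) (i : nat) (t : R) : R :=
  da D i * t + db D i.

Definition mu (R : realType) (D : fif_data R) (t : R) : R :=
  (t - dx D 0%N) / (dx D (dn D) - dx D 0%N).

Definition r (R : realType) (D : fif_data R) (i : nat) (t : R) : R :=
  (mu D t * dy D (idxn D i) + (1 - mu D t) * dy D (idx0 D i))
  - dp D i (L D i t) * (mu D t * dy D (dn D) + (1 - mu D t) * dy D 0%N)
  - dq D i (L D i t) * (mu D t * dz D (dn D) + (1 - mu D t) * dz D 0%N).

Definition rt (R : realType) (D : fif_data R) (i : nat) (t : R) : R :=
  (mu D t * dz D (idxn D i) + (1 - mu D t) * dz D (idx0 D i))
  - dpt D i (L D i t) * (mu D t * dy D (dn D) + (1 - mu D t) * dy D 0%N)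
  - dqt D i (L D i t) * (mu D t * dz D (dn D) + (1 - mu D t) * dz D 0%N).

Definition F1 (R : realType) (D : fif_data R) (i : nat) (t y z : R) : R :=
  dp D i (L D i t) * y + dq D i (L D i t) * z + r D i t.
Definition F2 (R : realType) (D : fif_data R) (i : nat) (t y z : R) : R :=
  dpt D i (L D i t) * y + dqt D i (L D i t) * z + rt D i t.

Definition omega (R : realType) (D : fif_data R) (i : nat) (u : R3 R) : R3 R :=
  (L D i u.1, (F1 D i u.1 u.2.1 u.2.2, F2 D i u.1 u.2.1 u.2.2)).

Definition np (R : realType) (D : fif_data R) (i : nat) : R :=
  supnorm (Ii D i) (dp D i).
Definition nq (R : realType) (D : fif_data R) (i : nat) : R :=
  supnorm (Ii D i) (dq D i).
Definition npt (R : realType) (D : fif_data R) (i : nat) : R :=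
  supnorm (Ii D i) (dpt D i).
Definition nqt (R : realType) (D : fif_data R) (i : nat) : R :=
  supnorm (Ii D i) (dqt D i).
Definition nr (R : realType) (D : fif_data R) (i : nat) : R :=
  supnorm (II D) (r D i).
Definition nrt (R : realType) (D : fif_data R) (i : nat) : R :=
  supnorm (II D) (rt D i).

(* Taking f 1 as the starting value makes this the maximum of f 1, ..., f n
   for n >= 1, whatever the signs. *)
Definition max1n (R : realType) (n : nat) (f : nat -> R) : R :=
  \big[Num.max/f 1%N]_(1 <= i < n.+1) f i.

Definition denom (R : realType) (D : fif_data R) (i : nat) : R :=
  (1 - np D i) * (1 - nqt D i) - npt D i * nq D i.

Definition U (R : realType) (D : fif_data R) : R :=
  max1n (dn D) (fun i =>
    (nq D i * nrt D i + (1 - nqt D i) * nr D i) / denom D i).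

Definition Ut (R : realType) (D : fif_data R) : R :=
  max1n (dn D) (fun i =>
    (npt D i * nr D i + (1 - np D i) * nrt D i) / denom D i).

Definition E (R : realType) (D : fif_data R) : set (R * R) :=
  `[- U D, U D] `*` `[- Ut D, Ut D].

Definition Sbar (R : realType) (D : fif_data R) : R :=
  max1n (dn D) (fun i => Num.max (np D i + npt D i) (nq D i + nqt D i)).

Definition contractive_on (R : realType) (T : Type) (d : T -> T -> R)
    (A : set T) (kappa : R) (w : T -> T) : Prop :=
  forall u v, A u -> A v -> d (w u) (w v) <= kappa * d u v.

(* Main.v *)
(* Take rho_theta(u, v) = |x - x'| + theta (|y - y'| + |z - z'|). Since n >= 2,
   the slopes satisfy |a_i| <= A < 1. The functions p_i, q_i, r_i, ... composed
   with L_i are Lipschitz on I, and y, z are bounded on E, so the fiber maps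
   obey |dF1| + |dF2| <= S (|dy| + |dz|) + C |dx| with S < 1. For theta small
   enough, A + theta C < 1, and max(A + theta C, S) is a contraction factor
   for all the maps omega_i. *)
Require Import Defs.
From mathcomp Require Import ring lra zify.

Set Implicit Arguments.
Unset Strict Implicit.
Unset Printing Implicit Defensive.

Local Open Scope classical_set_scope.
Local Open Scope ring_scope.

(** * Bounded Lipschitz functions on a subset of the line *)

Section ThetaMetric.
Variable R : realType.
Implicit Types (A : set R) (f g : R -> R) (a b s t C : R).

(** Boundedness is included because Lipschitz functions alone are not closed under products; a
    single constant serves both bounds. *)
Definition bounded_lipschitz A f : Prop :=
  exists C, [/\ 0 <= C, forall t, A t -> `|f t| <= C &
    forall s t, A s -> A t -> `|f s - f t| <= C * `|s - t|].

Lemma bounded_lipschitz_cst A c : bounded_lipschitz A (fun=> c).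
Proof.
exists `|c|; split=> // s t _ _.
by rewrite subrr normr0 mulr_ge0.
Qed.

Lemma bounded_lipschitzD A f g :
  bounded_lipschitz A f -> bounded_lipschitz A g ->
  bounded_lipschitz A (fun t => f t + g t).
Proof.
move=> [C [C0 Cb Cl]] [K [K0 Kb Kl]]; exists (C + K); split.
- exact: addr_ge0.
- by move=> t At; apply: le_trans (ler_normD _ _) _; apply: lerD; auto.
- move=> s t As At; rewrite opprD addrACA mulrDl.
  by apply: le_trans (ler_normD _ _) _; apply: lerD; auto.
Qed.

Lemma bounded_lipschitzN A f :
  bounded_lipschitz A f -> bounded_lipschitz A (fun t => - f t).
Proof.
move=> [C [C0 Cb Cl]]; exists C; split=> //.
- by move=> t At; rewrite normrN Cb.
- by move=> s t As At; rewrite -opprD normrN Cl.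
Qed.

Lemma bounded_lipschitzM A f g :
  bounded_lipschitz A f -> bounded_lipschitz A g ->
  bounded_lipschitz A (fun t => f t * g t).
Proof.
move=> [C [C0 Cb Cl]] [K [K0 Kb Kl]]; exists (C * K + C * K); split.
- by rewrite addr_ge0 // mulr_ge0.
- move=> t At; rewrite normrM.
  apply: (@le_trans _ _ (C * K)); first by apply: ler_pM; auto.
  by rewrite lerDl mulr_ge0.
- move=> s t As At.
  (* Each of the two terms costs [C * K], whence the doubled constant. *)
  have -> : f s * g s - f t * g t = f s * (g s - g t) + (f s - f t) * g t.
    by ring.
  apply: le_trans (ler_normD _ _) _; rewrite !normrM mulrDl.
  apply: lerD; first by rewrite -mulrA; apply: ler_pM; auto.
  by rewrite mulrAC; apply: ler_pM; auto.
Qed.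

Lemma bounded_lipschitz_affine a b c d :
  bounded_lipschitz `[a, b] (fun t => c * t + d).
Proof.
apply: bounded_lipschitzD (bounded_lipschitz_cst _ d).
apply: bounded_lipschitzM (bounded_lipschitz_cst _ c) _.
exists (1 + `|a| + `|b|); split.
- by rewrite !addr_ge0.
- move=> t; rewrite /= in_itv /= => /andP[at_ tb].
  have a0 := normr_ge0 a; have b0 := normr_ge0 b; have hb := ler_norm b.
  have := ler_norm (- a); rewrite normrN ler_norml => ha.
  by apply/andP; split; lra.
- move=> s t _ _; rewrite -[leLHS]mul1r ler_wpM2r // -addrA lerDl.
  by rewrite addr_ge0.
Qed.

Lemma bounded_lipschitz_comp A B f g :
  (forall t, A t -> B (g t)) ->
  bounded_lipschitz B f -> bounded_lipschitz A g ->
  bounded_lipschitz A (fun t => f (g t)).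
Proof.
move=> AB [C [C0 Cb Cl]] [K [K0 Kb Kl]]; exists (C + C * K); split.
- by rewrite addr_ge0 // mulr_ge0.
- move=> t At; apply: (@le_trans _ _ C); first by auto.
  by rewrite lerDl mulr_ge0.
- move=> s t As At; apply: le_trans (Cl _ _ (AB _ As) (AB _ At)) _.
  apply: (@le_trans _ _ (C * (K * `|s - t|))).
    by rewrite ler_wpM2l // Kl.
  by rewrite mulrA ler_wpM2r // lerDr.
Qed.

(** Boundedness comes from comparing with the value at [a]: the variation is at most the Lipschitz
    constant times [b - a]. *)
Lemma lipschitz_bounded_lipschitz a b f :
  [lipschitz f t | t in (`[a, b] : set R)] -> bounded_lipschitz `[a, b] f.
Proof.
move=> [M [_ hM]].
(* The hypothesis gives the estimate for every constant above [M]; [|M| + 1] is one that is also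
   nonnegative. *)
have {}hM : forall s t, `[a, b]%classic s -> `[a, b]%classic t ->
    `|f s - f t| <= (`|M| + 1) * `|s - t|.
  move=> s t As At.
  have MM : M < `|M| + 1 by rewrite (le_lt_trans (ler_norm M)) // ltrDl.
  exact: (hM _ MM (s, t)).
have K0 : 0 <= `|M| + 1 by rewrite addr_ge0.
set K := `|M| + 1 in hM K0.
(* For [b < a] the segment is empty and has no base point [a]. *)
have [ab|ba] := leP a b; last first.
  exists 0; split=> // [t|s t]; rewrite /= in_itv /= => /andP[h1 h2];
    by move: (lt_le_trans ba (le_trans h1 h2)); rewrite ltxx.
exists (K + `|f a| + K * (b - a)); split.
- by rewrite !addr_ge0 // mulr_ge0 // subr_ge0.
- move=> t At; have Aa : `[a, b]%classic a by rewrite /= in_itv /= lexx.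
  have := hM _ _ At Aa; have := ler_normB (f t - f a) (- f a).
  rewrite opprK subrK normrN => h1 h2; apply: (le_trans h1).
  have : K * `|t - a| <= K * (b - a).
    move: At; rewrite /= in_itv /= => /andP[h3 h4].
    by rewrite ler_wpM2l // ger0_norm ?subr_ge0 // lerD2r.
  by move=> h3; lra.
- move=> s t As At; apply: le_trans (hM _ _ As At) _.
  rewrite ler_wpM2r // -addrA lerDl addr_ge0 // mulr_ge0 // subr_ge0 //.
Qed.

(** * Sup norms, finite maxima and the variation of a fiber map *)

Lemma le_supnorm A f t : bounded_lipschitz A f -> A t -> `|f t| <= supnorm A f.
Proof.
move=> [C [_ Cb _]] At; apply: ub_le_sup; last by exists t.
by exists C => _ [s As <-]; exact: Cb.
Qed.

Lemma max1n_ge n (f : nat -> R) i : (1 <= i <= n)%N -> f i <= max1n n f.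
Proof. by move=> hi; apply: le_bigmax_seq; rewrite // mem_index_iota. Qed.

(** The starting value [f 1] must lie below [c] too; [1 <= n] puts it in the range. *)
Lemma max1n_lt n (f : nat -> R) c : (1 <= n)%N ->
  (forall i, (1 <= i <= n)%N -> f i < c) -> max1n n f < c.
Proof.
move=> n1 fc; rewrite /max1n big_nat_cond; apply: bigmax_lt => [|i].
  by apply: fc; rewrite leqnn n1.
by rewrite andbT ltnS; exact: fc.
Qed.

(* The variation of the coefficients is multiplied by y' and z' only, which is
   why only these two have to be bounded. *)
Lemma affine_fiber_bound A p q w Y Z :
  bounded_lipschitz A p -> bounded_lipschitz A q -> bounded_lipschitz A w ->
  exists2 C, 0 <= C & forall t t' y z y' z', A t -> A t' ->
    `|y'| <= Y -> `|z'| <= Z ->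
    `|(p t * y + q t * z + w t) - (p t' * y' + q t' * z' + w t')| <=
      `|p t| * `|y - y'| + `|q t| * `|z - z'| + C * `|t - t'|.
Proof.
move=> [P [P0 _ Pl]] [Q [Q0 _ Ql]] [W [W0 _ Wl]].
(* Absolute values make the constant nonnegative whatever the signs of [Y] and [Z]. *)
exists (P * `|Y| + Q * `|Z| + W).
  by rewrite !addr_ge0 // mulr_ge0.
move=> t t' y z y' z' At At' Yb Zb.
have -> : (p t * y + q t * z + w t) - (p t' * y' + q t' * z' + w t') =
  p t * (y - y') + q t * (z - z') +
  ((p t - p t') * y' + (q t - q t') * z' + (w t - w t')) by ring.
apply: le_trans (ler_normD _ _) _; apply: lerD.
  by apply: le_trans (ler_normD _ _) _; rewrite !normrM.
apply: le_trans (ler_normD _ _) _; rewrite ![in leRHS]mulrDl; apply: lerD; last exact: Wl.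
apply: le_trans (ler_normD _ _) _; rewrite !normrM !(mulrAC _ _ `|t - t'|).
apply: lerD; apply: ler_pM => //; try exact: Pl; try exact: Ql.
  exact: le_trans Yb (ler_norm _).
exact: le_trans Zb (ler_norm _).
Qed.

(** * The weighted sum metric and its equivalence with the Euclidean one *)

Definition theta_dist (theta : R) (u v : R3 R) : R :=
  `|u.1 - v.1| + theta * (`|u.2.1 - v.2.1| + `|u.2.2 - v.2.2|).

Lemma theta_dist_metric (theta : R) : 0 < theta -> is_metric (theta_dist theta).
Proof.
move=> t0; split.
- by move=> u v; rewrite addr_ge0 // mulr_ge0 ?addr_ge0 // ltW.
- move=> [x [y z]] [x' [y' z']]; rewrite /theta_dist /=; split; last first.
    by case=> -> -> ->; rewrite !subrr normr0 !(addr0, mulr0).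
  move/eqP; rewrite paddr_eq0 ?mulr_ge0 ?addr_ge0 // ?ltW //.
  rewrite mulf_eq0 (gt_eqF t0) /= paddr_eq0 // !normr_eq0 !subr_eq0.
  by move=> /and3P[/eqP-> /eqP-> /eqP->].
- move=> u v; rewrite /theta_dist distrC (distrC u.2.1) (distrC u.2.2) //.
- move=> u v w; rewrite /theta_dist.
  rewrite [leRHS]addrACA -mulrDr; apply: lerD; first exact: ler_distD.
  rewrite (ler_wpM2l (ltW t0)) //.
  by rewrite [leRHS]addrACA; apply: lerD; exact: ler_distD.
Qed.

(** The Euclidean distance lies between each coordinate difference and the sum of all three; as
    [theta <= 1], this gives the factors [theta] and [3]. *)
Lemma theta_dist_equiv (theta : R) : 0 < theta <= 1 ->
  equivalent_metrics (@euclidean_dist R) (theta_dist theta).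
Proof.
move=> /andP[t0 t1]; exists theta, 3; split=> // u v.
rewrite /euclidean_dist /theta_dist.
set x := u.1 - v.1; set y := u.2.1 - v.2.1; set z := u.2.2 - v.2.2.
have x0 := normr_ge0 x; have y0 := normr_ge0 y; have z0 := normr_ge0 z.
set e := Num.sqrt _; have e0 : 0 <= e by exact: sqrtr_ge0.
have le_e c : c ^+ 2 <= x ^+ 2 + y ^+ 2 + z ^+ 2 -> `|c| <= e.
  by move=> h; rewrite -sqrtr_sqr ler_wsqrtr.
have xe : `|x| <= e by apply: le_e; rewrite -addrA lerDl addr_ge0 // sqr_ge0.
have ye : `|y| <= e.
  by apply: le_e; rewrite addrAC lerDr addr_ge0 // sqr_ge0.
have ze : `|z| <= e by apply: le_e; rewrite lerDr addr_ge0 // sqr_ge0.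
have es : e <= `|x| + `|y| + `|z|.
  rewrite -[leRHS]ger0_norm ?addr_ge0 // -sqrtr_sqr ler_wsqrtr //.
  rewrite -(real_normK (num_real x)) -(real_normK (num_real y)).
  by rewrite -(real_normK (num_real z)); nra.
by apply/andP; split; nra.
Qed.

End ThetaMetric.

(** * Nodes, slopes and images of the affine maps *)

Section InterpolationMaps.
Variables (R : realType) (D : fif_data R).
Hypothesis hn : (2 <= dn D)%N.
Hypothesis hx : forall i : nat, (i < dn D)%N -> dx D i < dx D i.+1.
Hypothesis hL0 :
  forall i : nat, (1 <= i <= dn D)%N -> L D i (dx D 0%N) = dx D (idx0 D i).
Hypothesis hLn :
  forall i : nat, (1 <= i <= dn D)%N -> L D i (dx D (dn D)) = dx D (idxn D i).

Lemma nodes_lt i j : (i < j)%N -> (j <= dn D)%N -> dx D i < dx D j.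
Proof.
elim: j => // j IH; rewrite ltnS leq_eqVlt => /orP[/eqP->|ij] jn.
  exact: hx.
by apply: lt_trans (IH ij (ltnW jn)) (hx jn).
Qed.

Lemma nodes_le i j : (i <= j)%N -> (j <= dn D)%N -> dx D i <= dx D j.
Proof.
by rewrite leq_eqVlt => /orP[/eqP->//|ij] jn; apply/ltW/nodes_lt.
Qed.

Lemma width_gt0 : 0 < dx D (dn D) - dx D 0%N.
Proof. by rewrite subr_gt0; apply: nodes_lt => //; lia. Qed.

(** The signature only decides the orientation: [deps D i = true] is the reversed case. *)
Lemma L_endpoints i : (1 <= i <= dn D)%N ->
  (L D i (dx D 0%N) = dx D i.-1 /\ L D i (dx D (dn D)) = dx D i) \/
  (L D i (dx D 0%N) = dx D i /\ L D i (dx D (dn D)) = dx D i.-1).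
Proof.
move=> hi; rewrite hL0 // hLn // /idx0 /idxn; case: (deps D i) => /=.
  by right; split; congr (dx D _); lia.
by left; split; congr (dx D _); lia.
Qed.

(** The modulus of the slope is the length of [Ii D i] over that of [II D], and with at least two
    subintervals each one is strictly shorter than the whole. *)
Lemma slope_lt1 i : (1 <= i <= dn D)%N -> `|da D i| < 1.
Proof.
move=> hi; have w0 := width_gt0.
have lt_w : dx D i - dx D i.-1 < dx D (dn D) - dx D 0%N.
  (* The first subinterval misses a piece on the right of [II D], every later one a piece on the
     left. *)
  have [i1|i1] := leqP i 1.
    have -> : i = 1%N by lia.
    by rewrite ltrD2r nodes_lt.
  by apply: ler_ltD; [apply: nodes_le | rewrite ltrN2 nodes_lt]; lia.
have ge_w : 0 <= dx D i - dx D i.-1 by rewrite subr_ge0 nodes_le; lia.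
rewrite -(ltr_pM2r w0) mul1r -[X in _ * X]gtr0_norm // -normrM.
apply: le_lt_trans lt_w; rewrite -[leRHS]ger0_norm //.
have -> : da D i * (dx D (dn D) - dx D 0%N) =
    L D i (dx D (dn D)) - L D i (dx D 0%N) by rewrite /L; ring.
by case: (L_endpoints hi) => -[-> ->] //; rewrite distrC.
Qed.

Lemma L_maps i t : (1 <= i <= dn D)%N -> II D t -> Ii D i (L D i t).
Proof.
move=> hi; rewrite /II /Ii /= !in_itv /= => /andP[t0 tn].
have [a0|a0] := leP 0 (da D i).
  have h1 : L D i (dx D 0%N) <= L D i t by rewrite lerD2r ler_wpM2l.
  have h2 : L D i t <= L D i (dx D (dn D)) by rewrite lerD2r ler_wpM2l.
  (* The sign of the slope is not matched with the orientation; in a mismatched case [h1], [h2] and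
     [h3] force the values to coincide. *)
  have h3 : dx D i.-1 <= dx D i by apply: nodes_le; lia.
  by case: (L_endpoints hi) => -[e1 e2]; rewrite e1 e2 in h1 h2; lra.
have h1 : L D i t <= L D i (dx D 0%N) by rewrite lerD2r ler_wnM2l // ltW.
have h2 : L D i (dx D (dn D)) <= L D i t by rewrite lerD2r ler_wnM2l // ltW.
have h3 : dx D i.-1 <= dx D i by apply: nodes_le; lia.
by case: (L_endpoints hi) => -[e1 e2]; rewrite e1 e2 in h1 h2; lra.
Qed.

Lemma bounded_lipschitz_L i f : (1 <= i <= dn D)%N ->
  [lipschitz f t | t in Ii D i] ->
  bounded_lipschitz (II D) (fun t => f (L D i t)).
Proof.
move=> hi fl; apply: (@bounded_lipschitz_comp _ _ (Ii D i)).
- by move=> t; apply: L_maps.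
- exact: lipschitz_bounded_lipschitz.
- exact: bounded_lipschitz_affine.
Qed.

Lemma bounded_lipschitz_mix c d :
  bounded_lipschitz (II D) (fun t => mu D t * c + (1 - mu D t) * d).
Proof.
have muL : bounded_lipschitz (II D) (mu D).
  apply: bounded_lipschitzM (bounded_lipschitz_cst _ _).
  have := @bounded_lipschitz_affine R (dx D 0%N) (dx D (dn D)) 1 (- dx D 0%N).
  by congr bounded_lipschitz; apply/funext => t; rewrite mul1r.
apply: bounded_lipschitzD; apply: bounded_lipschitzM => //;
  try exact: bounded_lipschitz_cst.
apply: bounded_lipschitzD; first exact: bounded_lipschitz_cst.
exact: bounded_lipschitzN.
Qed.

(** * The fiber estimate for one map *)

Section OneMap.
Variable i : nat.
Hypothesis hi : (1 <= i <= dn D)%N.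
Hypothesis hp : [lipschitz dp D i t | t in Ii D i].
Hypothesis hq : [lipschitz dq D i t | t in Ii D i].
Hypothesis hpt : [lipschitz dpt D i t | t in Ii D i].
Hypothesis hqt : [lipschitz dqt D i t | t in Ii D i].

Lemma bounded_lipschitz_r : bounded_lipschitz (II D) (r D i).
Proof.
apply: bounded_lipschitzD; first apply: bounded_lipschitzD.
- exact: bounded_lipschitz_mix.
- by apply/bounded_lipschitzN/bounded_lipschitzM;
    [exact: bounded_lipschitz_L | exact: bounded_lipschitz_mix].
- by apply/bounded_lipschitzN/bounded_lipschitzM;
    [exact: bounded_lipschitz_L | exact: bounded_lipschitz_mix].
Qed.

Lemma bounded_lipschitz_rt : bounded_lipschitz (II D) (rt D i).
Proof.
apply: bounded_lipschitzD; first apply: bounded_lipschitzD.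
- exact: bounded_lipschitz_mix.
- by apply/bounded_lipschitzN/bounded_lipschitzM;
    [exact: bounded_lipschitz_L | exact: bounded_lipschitz_mix].
- by apply/bounded_lipschitzN/bounded_lipschitzM;
    [exact: bounded_lipschitz_L | exact: bounded_lipschitz_mix].
Qed.

(** Adding the two component estimates gives [|y - y'|] the coefficient [|p| + |pt|] and [|z - z'|]
    the coefficient [|q| + |qt|]. These are the sums bounded by [Sbar D], which is why the fiber
    carries the sum norm. *)
Lemma omega_fiber_bound :
  exists2 C, 0 <= C & forall u v, (II D `*` E D) u -> (II D `*` E D) v ->
    `|(omega D i u).2.1 - (omega D i v).2.1| +
    `|(omega D i u).2.2 - (omega D i v).2.2| <=
      Sbar D * (`|u.2.1 - v.2.1| + `|u.2.2 - v.2.2|) + C * `|u.1 - v.1|.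
Proof.
have [C C0 hC] := @affine_fiber_bound R _ _ _ _ (U D) (Ut D)
  (bounded_lipschitz_L hi hp) (bounded_lipschitz_L hi hq) bounded_lipschitz_r.
have [K K0 hK] := @affine_fiber_bound R _ _ _ _ (U D) (Ut D)
  (bounded_lipschitz_L hi hpt) (bounded_lipschitz_L hi hqt)
  bounded_lipschitz_rt.
exists (C + K); first exact: addr_ge0.
move=> [x [y z]] [x' [y' z']] [/= Ix _] [/= Ix' [/= hy hz]].
rewrite !in_itv /= -!ler_norml in hy hz.
have {}hC := hC _ _ y z _ _ Ix Ix' hy hz.
have {}hK := hK _ _ y z _ _ Ix Ix' hy hz.
rewrite /F1 /F2; apply: le_trans (lerD hC hK) _.
have ILx := L_maps hi Ix.
have bp : `|dp D i (L D i x)| <= np D i.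
  by apply: le_supnorm => //; exact: lipschitz_bounded_lipschitz.
have bq : `|dq D i (L D i x)| <= nq D i.
  by apply: le_supnorm => //; exact: lipschitz_bounded_lipschitz.
have bpt : `|dpt D i (L D i x)| <= npt D i.
  by apply: le_supnorm => //; exact: lipschitz_bounded_lipschitz.
have bqt : `|dqt D i (L D i x)| <= nqt D i.
  by apply: le_supnorm => //; exact: lipschitz_bounded_lipschitz.
have : Num.max (np D i + npt D i) (nq D i + nqt D i) <= Sbar D.
  exact: (max1n_ge (fun i => Num.max (np D i + npt D i) (nq D i + nqt D i)) hi).
rewrite ge_max => /andP[Sp Sq].
have hy0 := normr_ge0 (y - y'); have hz0 := normr_ge0 (z - z').
have e1 := ler_wpM2r hy0 (le_trans (lerD bp bpt) Sp).
have e2 := ler_wpM2r hz0 (le_trans (lerD bq bqt) Sq).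
lra.
Qed.

End OneMap.

End InterpolationMaps.

(** * Choice of [theta] and of a common contraction factor *)

Theorem theorem1 (R : realType) (D : fif_data R)
  (hn : (2 <= dn D)%N)
  (hx : forall i : nat, (i < dn D)%N -> dx D i < dx D i.+1)
  (hL0 : forall i : nat, (1 <= i <= dn D)%N -> L D i (dx D 0%N) = dx D (idx0 D i))
  (hLn : forall i : nat, (1 <= i <= dn D)%N -> L D i (dx D (dn D)) = dx D (idxn D i))
  (hp : forall i : nat, (1 <= i <= dn D)%N -> [lipschitz dp D i t | t in Ii D i])
  (hq : forall i : nat, (1 <= i <= dn D)%N -> [lipschitz dq D i t | t in Ii D i])
  (hpt : forall i : nat, (1 <= i <= dn D)%N -> [lipschitz dpt D i t | t in Ii D i])
  (hqt : forall i : nat, (1 <= i <= dn D)%N -> [lipschitz dqt D i t | t in Ii D i])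
  (hpp : forall i : nat, (1 <= i <= dn D)%N -> np D i + npt D i < 1)
  (hqq : forall i : nat, (1 <= i <= dn D)%N -> nq D i + nqt D i < 1)
  (hS : Sbar D < 1) :
  exists rho : R3 R -> R3 R -> R,
    [/\ is_metric rho,
        equivalent_metrics (@euclidean_dist R) rho &
        exists2 kappa : R, kappa < 1 &
          forall i : nat, (1 <= i <= dn D)%N ->
            contractive_on rho (II D `*` E D) kappa (omega D i)].
Proof.
(* The range condition sits under the existential so that a constant exists for every natural [i],
   with [0] outside the range, and [choice] yields a total function [K]. *)
have bound i : exists C, 0 <= C /\ ((1 <= i <= dn D)%N ->
    forall u v, (II D `*` E D) u -> (II D `*` E D) v ->
    `|(omega D i u).2.1 - (omega D i v).2.1| +
    `|(omega D i u).2.2 - (omega D i v).2.2| <=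
      Sbar D * (`|u.2.1 - v.2.1| + `|u.2.2 - v.2.2|) + C * `|u.1 - v.1|).
  have [hi|_] := boolP (1 <= i <= dn D)%N; last by exists 0.
  have [C C0 hC] := omega_fiber_bound hn hx hL0 hLn hi (hp i hi) (hq i hi)
    (hpt i hi) (hqt i hi).
  by exists C.
have [K hK] := choice bound.
pose A := max1n (dn D) (fun i => `|da D i|).
pose C := max1n (dn D) K.
have n1 : (1 <= 1 <= dn D)%N by lia.
have A1 : A < 1.
  by apply: max1n_lt => [|i hi]; [lia | exact: (slope_lt1 hn hx hL0 hLn hi)].
have A0 : 0 <= A by apply: le_trans (max1n_ge _ n1); exact: normr_ge0.
have C0 : 0 <= C by apply: le_trans (max1n_ge _ n1); case: (hK 1%N).
(* Chosen so that A + theta * C <= (1 + A) / 2. *)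
pose theta := (1 - A) / (2 * (C + 1)).
have th0 : 0 < theta by rewrite divr_gt0 //; lra.
have thC : theta * (2 * (C + 1)) = 1 - A by rewrite divfK //; apply/eqP; lra.
have thC0 : 0 <= theta * C by rewrite mulr_ge0 // ltW.
exists (theta_dist theta); split.
- exact: theta_dist_metric.
- by apply: theta_dist_equiv; rewrite th0 /=; lra.
(* The first entry controls the coefficient of the horizontal distance, the second that of the fiber
   distance, uniformly in [i]. *)
exists (Num.max ((1 + A) / 2) (Sbar D)).
  by rewrite gt_max hS andbT; lra.
move=> i hi u v hu hv; have [_ /(_ hi u v hu hv)] := hK i.
have Ai : `|da D i| <= A := max1n_ge (fun i => `|da D i|) hi.
have Ci : K i <= C := max1n_ge K hi.
rewrite /theta_dist; set k := Num.max _ _.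
have k1 : (1 + A) / 2 <= k by rewrite le_max lexx.
have k2 : Sbar D <= k by rewrite le_max lexx orbT.
have -> : (omega D i u).1 - (omega D i v).1 = da D i * (u.1 - v.1).
  by rewrite /= /L; ring.
rewrite normrM; set X := `|u.1 - v.1|; set Y := `|u.2.1 - v.2.1| + _.
move=> hF.
have X0 : 0 <= X by exact: normr_ge0.
have Y0 : 0 <= Y by rewrite addr_ge0.
apply: le_trans (lerD (ler_wpM2r X0 Ai) (ler_wpM2l (ltW th0) hF)) _.
have e1 := ler_wpM2l (ltW th0) (ler_wpM2r X0 Ci).
have e2 := ler_wpM2l (ltW th0) (ler_wpM2r Y0 k2).
(* By [thC], [theta * C] equals [(1 - A) / 2 - theta], so the coefficient is below [(1 + A) / 2]. *)
have e3 : (A + theta * C) * X <= k * X by rewrite ler_wpM2r //; lra.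
lra.
Qed.
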